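(* Let $N\ge 1$ and let $\boldsymbol{f}:\mathcal{U}(N)\to\mathbb{R}^{N^2}$ be the map $\boldsymbol{f}(\boldsymbol{U})=\boldsymbol{U}_{\mathcal{B}}^{\mathrm{H}}\,\mathrm{vec}(\log(\boldsymbol{U}))$, where $\log$ is the principal logarithm of a unitary matrix and $\boldsymbol{U}_{\mathcal{B}}$ is the matrix of vectorized basis elements of $\mathfrak{u}(N)$ (both defined in the context). Then the image of $\mathcal{U}(N)$ under $\boldsymbol{f}$ is contained in the compact set $[-\sqrt{N}\pi,\sqrt{N}\pi]^{N^2}\subset\mathbb{R}^{N^2}$; that is, for every $\boldsymbol{U}\in\mathcal{U}(N)$, the entries $f_i(\boldsymbol{U})$ of $\boldsymbol{f}(\boldsymbol{U})$ satisfy $$f_i(\boldsymbol{U})\in[-\sqrt{N}\pi,\sqrt{N}\pi]\qquad\text{for all } i\in\{1,\dots,N^2\}.$$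
   Context: $\mathcal{U}(N)$ is the group of $N\times N$ complex unitary matrices, and $\mathfrak{u}(N)=\{\boldsymbol{X}\in\mathbb{C}^{N\times N}:\boldsymbol{X}^{\mathrm{H}}+\boldsymbol{X}=\mathbf{0}\}$ is the real vector space of skew-Hermitian matrices. $\mathrm{j}$ is the imaginary unit, $(\cdot)^{\mathrm{H}}$ is conjugate transpose, and $\mathrm{vec}(\cdot)$ stacks the columns of an $N\times N$ matrix into a vector of length $N^2$. Principal logarithm: for $\boldsymbol{U}\in\mathcal{U}(N)$ take a unitary diagonalization $\boldsymbol{U}=\boldsymbol{Q}\,\mathrm{diag}(e^{\mathrm{j}\varphi_1},\dots,e^{\mathrm{j}\varphi_N})\,\boldsymbol{Q}^{\mathrm{H}}$ with $\boldsymbol{Q}$ unitary and $\varphi_n\in(-\pi,\pi]$ for all $n$, and set $\log(\boldsymbol{U})=\boldsymbol{Q}\,\mathrm{diag}(\mathrm{j}\varphi_1,\dots,\mathrm{j}\varphi_N)\,\boldsymbol{Q}^{\mathrm{H}}\in\mathfrak{u}(N)$ (this does not depend on the chosen diagonalization). Basis: let $\boldsymbol{E}_{k,l}$ be the $N\times N$ matrix with a $1$ in position $(k,l)$ and zeros elsewhere. Enumerate the pairs $(k,l)$ with $1\le k<l\le N$ by traversing the strictly upper triangular part row by row, and denote the $m$-th pair by $(k(m),l(m))$, $m=1,\dots,N(N-1)/2$. Define - $\boldsymbol{B}_1=\frac{\mathrm{j}}{\sqrt{N}}\mathbf{I}_N$; - $\boldsymbol{B}_n=\frac{\mathrm{j}}{\sqrt{n(n-1)}}\left(\sum_{i=1}^{n-1}\boldsymbol{E}_{i,i}-(n-1)\boldsymbol{E}_{n,n}\right)$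 for $n=2,\dots,N$; - $\boldsymbol{B}_n=\frac{\mathrm{j}}{\sqrt{2}}\left(\boldsymbol{E}_{k(n'),l(n')}+\boldsymbol{E}_{l(n'),k(n')}\right)$ for $n=N+1,\dots,\frac{N(N+1)}{2}$, with $n'=n-N$; - $\boldsymbol{B}_n=\frac{1}{\sqrt{2}}\left(\boldsymbol{E}_{k(n''),l(n'')}-\boldsymbol{E}_{l(n''),k(n'')}\right)$ for $n=\frac{N(N+1)}{2}+1,\dots,N^2$, with $n''=n-\frac{N(N+1)}{2}$. These matrices form an orthonormal basis of the real vector space $\mathfrak{u}(N)$ for the inner product $\langle\boldsymbol{A},\boldsymbol{B}\rangle=\mathrm{trace}(\boldsymbol{A}^{\mathrm{H}}\boldsymbol{B})$. Set $\boldsymbol{U}_{\mathcal{B}}=[\mathrm{vec}(\boldsymbol{B}_1),\dots,\mathrm{vec}(\boldsymbol{B}_{N^2})]$, an $N^2\times N^2$ matrix. *)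

(* Defs.v *)
From mathcomp Require Import all_boot all_order all_algebra.
From mathcomp Require Import complex.
From mathcomp Require Import all_classical all_reals all_analysis.

Set Implicit Arguments.
Unset Strict Implicit.
Unset Printing Implicit Defensive.

Import Order.TTheory GRing.Theory Num.Theory.

Local Open Scope ring_scope.
Local Open Scope classical_set_scope.
Local Open Scope complex_scope.
Local Open Scope sesquilinear_scope.

Definition cis (R : realType) (phi : R) : R[i] := cos phi +i* sin phi.

Definition is_principal_log (R : realType) (N : nat) (U L : 'M[R[i]]_N) : Prop :=
  exists (Q : 'M[R[i]]_N) (phi : 'I_N -> R),
    [/\ Q \is unitarymx,
        forall n, - pi < phi n <= pi,
        U = Q *m diag_mx (\row_n cis (phi n)) *m Q^t* &
        L = Q *m diag_mx (\row_n ('i%C * (phi n)%:C)) *m Q^t*].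

(* On unitary matrices the default value 0 is never used and the chosen value
   is the only possible one: see principal_logP and principal_log_unique. *)
Definition principal_log (R : realType) (N : nat) (U : 'M[R[i]]_N) :
    'M[R[i]]_N :=
  xget 0 (is_principal_log U).

Lemma cis_onto (R : realType) (z : R[i]) : `|z| = 1 ->
  exists2 phi : R, - pi < phi <= pi & cis phi = z.
Proof.
case: z => x y; rewrite normc_def /= => -[] xy1'.
have xy1 : x ^+ 2 + y ^+ 2 = 1.
  by rewrite -[LHS]sqr_sqrtr ?addr_ge0 ?sqr_ge0 // xy1' expr1n.
have x11 : -1 <= x <= 1.
  rewrite -ler_norml -(@expr_le1 _ 2%N) // real_normK ?num_real //.
  by rewrite -xy1 lerDl sqr_ge0.
have siny : sin (acos x) = `|y|.
  by rewrite sin_acos // -sqrtr_sqr -xy1 addrC addKr.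
have cosx : cos (acos x) = x by rewrite acosK // in_itv.
have [y0|y0] := leP 0 y.
  exists (acos x); last by rewrite /cis siny cosx ger0_norm.
  rewrite acos_lepi // andbT (lt_le_trans _ (acos_ge0 x11)) //.
  by rewrite oppr_lt0 pi_gt0.
exists (- acos x); last by rewrite /cis sinN cosN siny cosx ltr0_norm // opprK.
rewrite ltrN2 (@le_trans _ _ 0) ?oppr_le0 ?acos_ge0 ?pi_ge0 // andbT.
rewrite acos_ltpi //; case/andP: x11 => x1 ->; rewrite andbT lt_neqAle x1 andbT.
apply/eqP => x1E; move: xy1; rewrite -x1E sqrrN expr1n => /eqP.
by rewrite -[X in _ == X]addr0 (inj_eq (addrI _)) sqrf_eq0 lt_eqF.
Qed.

Lemma cis_inj (R : realType) (a b : R) : - pi < a <= pi -> - pi < b <= pi ->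
  cis a = cis b -> a = b.
Proof.
wlog ab : a b / `|a| = a => [H|].
  move=> ha hb cab; have [a0|a0] := leP 0 a; first by apply: H; rewrite ?ger0_norm.
  have [b0|b0] := leP 0 b; first by apply/esym; apply: H => //; rewrite ?ger0_norm.
  have apos : `|- a| = - a by rewrite ger0_norm // oppr_ge0 ltW.
  have K c : - pi < c <= pi -> c < 0 -> - pi < - c <= pi.
    case/andP=> c1 _ c0; rewrite ltrN2 lerNl (ltW c1) andbT.
    by rewrite (lt_trans c0) ?pi_gt0.
  apply: oppr_inj; apply: H => //; [exact: K|exact: K|].
  by case: cab => cc ss; rewrite /cis !cosN !sinN cc ss.
move: ab => a0 /andP[api1 api] /andP[bpi1 bpi] [cc ss].
have abs_in c : - pi < c -> c <= pi -> `|c| \in `[0, (pi : R)]%R.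
  by move=> c1 c2; rewrite in_itv /= normr_ge0 ler_norml (ltW c1).
have cosn (c : R) : cos `|c| = cos c by case: ler0P => // _; rewrite cosN.
have eqab : `|a| = `|b| by apply: cos_inj; rewrite ?abs_in // !cosn.
have [b0|b0] := leP 0 b; first by rewrite -a0 eqab ger0_norm.
have aE : a = - b by rewrite -a0 eqab ltr0_norm.
have : 0 < sin a.
  apply: sin_gt0_pi; rewrite aE oppr_gt0 b0 /= ltrNl //.
have : sin b < 0.
  by rewrite -[b]opprK -aE sinN oppr_lt0 sin_gt0_pi // aE oppr_gt0 b0 ltrNl.
by rewrite ss => /lt_trans/[apply]; rewrite ltxx.
Qed.

Lemma principal_logP (R : realType) (N : nat) (U : 'M[R[i]]_N) :
  U \is unitarymx -> is_principal_log U (principal_log U).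
Proof.
move=> Uu; apply: xgetPex.
have Un : U \is normalmx.
  by apply/normalmxP; rewrite (unitarymxP Uu) -(invmx_unitary Uu) mulVmx
     ?unitarymx_unit.
have Pu := spectral_unitarymx U.
move/orthomx_spectralP: Un; rewrite (invmx_unitary Pu).
set P := spectralmx U in Pu *; set D := spectral_diag U; move=> UE.
have PP : P *m P^t* = 1%:M by apply/unitarymxP.
have DE : diag_mx D = P *m U *m P^t*.
  by rewrite UE !mulmxA PP mul1mx -mulmxA PP mulmx1.
have Du : diag_mx D \is unitarymx.
  by rewrite DE !mul_unitarymx // trmxC_unitary.
have Dn n : `|D 0 n| = 1.
  have := unitarymxP Du => /matrixP/(_ n n).
  rewrite tr_diag_mx map_diag_mx mulmx_diag !mxE eqxx !mulr1n -normCK => /eqP.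
  by rewrite sqrp_eq1 // => /eqP.
have /choice[phi phiP] n : exists phi : R, - pi < phi <= pi /\ cis phi = D 0 n.
  by have [p ? ?] := cis_onto (Dn n); exists p.
exists (P^t* *m diag_mx (\row_n ('i%C * (phi n)%:C)) *m (P^t*)^t*).
exists (P^t*); exists phi.
split=> //; first by rewrite trmxC_unitary.
  by move=> n; case: (phiP n).
rewrite trmxCK [LHS]UE; congr (_ *m diag_mx _ *m _).
by apply/rowP => n; rewrite !mxE; case: (phiP n).
Qed.

Lemma principal_log_unique (R : realType) (N : nat) (U L L' : 'M[R[i]]_N) :
  is_principal_log U L -> is_principal_log U L' -> L = L'.
Proof.
move=> [Q [phi [Qu hphi UE LE]]] [P [psi [Pu hpsi UE' LE']]].
have QQ : Q^t* *m Q = 1%:M by rewrite -invmx_unitary // mulVmx ?unitarymx_unit.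
have PP : P^t* *m P = 1%:M by rewrite -invmx_unitary // mulVmx ?unitarymx_unit.
have QQ' : Q *m Q^t* = 1%:M by apply/unitarymxP.
have PP' : P *m P^t* = 1%:M by apply/unitarymxP.
pose W := P^t* *m Q.
have WD : W *m diag_mx (\row_n cis (phi n)) = diag_mx (\row_n cis (psi n)) *m W.
  have := congr1 (fun A => P^t* *m A *m Q) (etrans (esym UE) UE').
  by rewrite /W !mulmxA PP mul1mx -!(mulmxA _ (Q^t*) Q) QQ mulmx1.
have WF : W *m diag_mx (\row_n ('i%C * (phi n)%:C)) =
          diag_mx (\row_n ('i%C * (psi n)%:C)) *m W.
  move: (W) WD => V VD; apply/matrixP => i j.
  have := congr1 (fun A : 'M[R[i]]_N => A i j) VD.
  rewrite !mul_mx_diag !mul_diag_mx !mxE [X in _ = X -> _]mulrC.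
  have [->|V0 /(mulfI V0) c] := eqVneq (V i j) 0; first by rewrite !mul0r !mulr0.
  by rewrite (cis_inj (hphi j) (hpsi i) c) mulrC.
have := congr1 (fun A => P *m A *m Q^t*) WF.
by rewrite LE LE' /W !mulmxA PP' mul1mx -!(mulmxA _ Q (Q^t*)) QQ' mulmx1.
Qed.

(* The library's mxvec stacks rows, hence the inner transpose. *)
Definition vec (T : Type) (N : nat) (A : 'M[T]_N) : 'cV[T]_(N ^ 2) :=
  (mxvec A^T)^T.

(* Row and column indices start at 1 here, as does the numbering of the pairs
   and of the basis below. *)
Definition Eunit (R : realType) (N k l : nat) : 'M[R[i]]_N :=
  \matrix_(i, j) ((i.+1 == k) && (j.+1 == l))%:R.

Definition upper_pairs (N : nat) : seq (nat * nat) :=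
  [seq (k, l) | k <- iota 1 N, l <- iota k.+1 (N - k)].

Definition upper_pair (N m : nat) : nat * nat :=
  nth (0, 0)%N (upper_pairs N) m.-1.

(* Meaningful for 1 <= n <= N ^ 2. *)
Definition skewherm_basis (R : realType) (N n : nat) : 'M[R[i]]_N :=
  if (n == 1)%N then ('i%C / (Num.sqrt N%:R)%:C) *: 1%:M
  else if (n <= N)%N then
    ('i%C / (Num.sqrt (n * n.-1)%:R)%:C) *:
      (\sum_(1 <= i < n) Eunit R N i i - n.-1%:R *: Eunit R N n n)
  else if (n <= (N * N.+1)./2)%N then
    let: (k, l) := upper_pair N (n - N) in
    ('i%C / (Num.sqrt 2)%:C) *: (Eunit R N k l + Eunit R N l k)
  else
    let: (k, l) := upper_pair N (n - (N * N.+1)./2) in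
    (1 / (Num.sqrt 2)%:C) *: (Eunit R N k l - Eunit R N l k).

Definition basis_mx (R : realType) (N : nat) : 'M[R[i]]_(N ^ 2) :=
  \matrix_(p, q) vec (skewherm_basis R N q.+1) p 0.

(* On unitary matrices the entries are real, but this is not built into the
   definition. *)
Definition log_coord (R : realType) (N : nat) (U : 'M[R[i]]_N) :
    'cV[R[i]]_(N ^ 2) :=
  (basis_mx R N)^t* *m vec (principal_log U).

Definition cube (R : realType) (d : nat) (b : R) : set 'cV[R]_d :=
  [set x : 'cV[R]_d | forall i, - b <= x i 0 <= b].

(* Main.v *)
(* Each coordinate is the Frobenius product <B, L> = tr(B^H L) of a basis matrix
   B with L = log U.  It is real because B and L are skew-Hermitian, and
   Cauchy-Schwarz with |B| <= 1 bounds its square by |L|^2.  By unitary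
   invariance |L|^2 is the sum of the squared angles phi_n^2 <= pi^2. *)
Require Import Defs.
From mathcomp Require Import all_boot all_order all_algebra.
From mathcomp Require Import complex ring.
From mathcomp Require Import all_classical all_reals all_analysis.
Import numFieldNormedType.Exports.

Local Open Scope ring_scope.
Local Open Scope classical_set_scope.

Set Implicit Arguments.
Unset Strict Implicit.
Unset Printing Implicit Defensive.

Import Order.TTheory GRing.Theory Num.Theory.

Local Open Scope sesquilinear_scope.

(** Products of compact intervals are compact by [rV_compact], which concerns row vectors; the cube
    is the image of such a product under the continuous map [trmx]. *)
Lemma compact_cube (R : realType) (d : nat) (b : R) : compact (@cube R d b).
Proof.
have -> : @cube R d b =
    trmx @` [set v : 'rV[R]_d | forall i, `[- b, b]%classic (v ord0 i)].
  apply/seteqP; split => [x xb|_ [v vb <-]].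
    exists x^T; rewrite ?trmxK // => i; rewrite /= in_itv /= mxE.
    exact: xb.
  by move=> i; have := vb i; rewrite /= in_itv /= mxE.
apply: continuous_compact; last first.
  by apply: (@rV_compact R d (fun=> `[- b, b]%classic)) => i;
    exact: segment_compact.
(* A neighbourhood of a matrix contains a box of entrywise neighbourhoods [P i j]; swapping the two
   indices gives a box in the preimage. *)
apply: continuous_subspaceT => v A [P vP PA].
exists (fun i j => P j i); first by move=> i j; have := vP j i; rewrite mxE.
by move=> w wP; apply: PA => i j; rewrite mxE; exact: wP.
Qed.

(** * The Frobenius product of square matrices *)

Section Frobenius.
Variables (C : numClosedFieldType) (n : nat).
Implicit Types A B L D Q : 'M[C]_n.

Definition frob A B : C := \tr (A^t* *m B).

Lemma frobE A B : frob A B = \sum_i \sum_j (A i j)^* * B i j.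
Proof.
rewrite exchange_big; apply: eq_bigr => j _; rewrite !mxE.
by apply: eq_bigr => i _; rewrite !mxE.
Qed.

Lemma frobxx A : frob A A = \sum_i \sum_j `|A i j| ^+ 2.
Proof.
by rewrite frobE; apply: eq_bigr => i _; apply: eq_bigr => j _;
  rewrite mulrC -normCK.
Qed.

Lemma frob_conj A B : (frob A B)^* = frob B A.
Proof.
rewrite !frobE rmorph_sum; apply: eq_bigr => i _.
by rewrite rmorph_sum; apply: eq_bigr => j _; rewrite rmorphM /= conjCK mulrC.
Qed.

(** Conjugation swaps the arguments; skewness turns both products into minus a trace, and tr(AB) =
    tr(BA). *)
Lemma frob_skew_real A B : A^t* = - A -> B^t* = - B -> frob A B \is Num.real.
Proof.
move=> hA hB; apply/CrealP; rewrite frob_conj /frob hA hB.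
by rewrite !mulNmx !raddfN /= mxtrace_mulC.
Qed.

Lemma frobZ c A : frob (c *: A) (c *: A) = `|c| ^+ 2 * frob A A.
Proof.
rewrite !frobxx mulr_sumr; apply: eq_bigr => i _.
by rewrite mulr_sumr; apply: eq_bigr => j _; rewrite mxE normrM exprMn.
Qed.

(* Expand |L - t B|^2 >= 0 at t = <B, L>. *)
Lemma frob_sqr_le B L : frob B B <= 1 -> frob B L \is Num.real ->
  frob B L ^+ 2 <= frob L L.
Proof.
set t := frob B L => hB tr.
have tc : t^* = t by apply/CrealP.
have LB : frob L B = t by rewrite -frob_conj tc.
(* Since [t] is real, both cross terms of the expansion equal [t ^+ 2]. *)
have E : frob (L - t *: B) (L - t *: B) = frob L L - t ^+ 2 * (2 - frob B B).
  have -> : frob (L - t *: B) (L - t *: B) =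
      frob L L - t * frob L B - t * frob B L + t ^+ 2 * frob B B.
    rewrite !frobE !mulr_sumr -!sumrN -!big_split /=; apply: eq_bigr => i _.
    rewrite !mulr_sumr -!sumrN -!big_split /=; apply: eq_bigr => j _.
    by rewrite !mxE rmorphB rmorphM /= tc; ring.
  by rewrite LB -/t; ring.
have : 0 <= frob (L - t *: B) (L - t *: B).
  rewrite frobxx; apply: sumr_ge0 => i _; apply: sumr_ge0 => j _.
  by rewrite exprn_ge0.
(* The factor [2 - frob B B] is at least 1, and [t ^+ 2] is nonnegative because [t] is real. *)
rewrite E subr_ge0; apply: le_trans; rewrite ler_peMr ?real_exprn_even_ge0 //.
by rewrite lerBrDr -lerBrDl; apply: le_trans hB _; rewrite lerBrDr.
Qed.

(** The inner [Q^t* *m Q] cancels at once, the outer pair after a cyclic rotation under the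
    trace. *)
Lemma frob_unitary_conj Q D : Q \is unitarymx ->
  frob (Q *m D *m Q^t*) (Q *m D *m Q^t*) = frob D D.
Proof.
move=> Qu; have QQ : Q^t* *m Q = 1%:M.
  by rewrite -invmx_unitary // mulVmx // unitarymx_unit.
have E : (Q *m D *m Q^t*)^t* = Q *m D^t* *m Q^t*.
  by rewrite !trmx_mul !map_mxM /= trmxCK mulmxA.
by rewrite /frob E -!mulmxA mxtrace_mulC !mulmxA -!(mulmxA _ (Q^t*) Q) QQ
  !mulmx1.
Qed.

(** Serves the basis matrices with the factor i: each is an imaginary multiple of a real symmetric
    matrix. *)
Lemma skew_scaleI c A : c^* = - c -> A^t* = A -> (c *: A)^t* = - (c *: A).
Proof.
move=> hc hA; rewrite -{2}hA; apply/matrixP => i j.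
by rewrite !mxE rmorphM /= hc mulNr.
Qed.

Lemma skew_scale_real c A : c^* = c -> A^t* = - A -> (c *: A)^t* = - (c *: A).
Proof.
move=> hc hA; rewrite -scalerN -hA; apply/matrixP => i j.
by rewrite !mxE rmorphM /= hc.
Qed.

End Frobenius.
Arguments frob {C n}.

Local Open Scope complex_scope.

(* Out of range, nth returns (0, 0), for which Eunit is the zero matrix. *)
Lemma upper_pair_lt (N m : nat) :
  ((upper_pair N m).1 < (upper_pair N m).2)%N \/ upper_pair N m = (0, 0)%N.
Proof.
rewrite /upper_pair; have [lt|ge] := ltnP m.-1 (size (upper_pairs N)).
  left; have /allpairsPdep[k [l [_ + ->]]] := mem_nth (0, 0)%N lt.
  by rewrite mem_iota => /andP[].
by right; rewrite nth_default.
Qed.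

(** Only an inequality, since the sum vanishes when [k] is 0 or exceeds [N]. *)
Lemma sum_succ_eq_le1 (N k : nat) : (\sum_(i < N) (i.+1 == k) <= 1)%N.
Proof.
case: (pickP (fun i : 'I_N => i.+1 == k)) => [i0 /eqP i0k|none].
  rewrite (bigD1 i0) //= i0k eqxx big1 // => i /negPf ii0.
  by rewrite -i0k eqSS [_ == _]ii0.
by rewrite big1 // => i _; rewrite none.
Qed.

(** * The basis matrices: skew-Hermitian, of norm at most 1 *)

Section Basis.
Variable R : realType.

Lemma real_complex_real (r : R) : r%:C \is Num.real.
Proof. by rewrite realE -[0]/(0%:C) !lecR le_total. Qed.

Lemma conj_imag_div (r : R) : ('i%C / r%:C)^*%R = - ('i%C / r%:C) :> R[i].
Proof.
by rewrite rmorphM /= fmorphV /= complexiE conjCi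
  (CrealP (real_complex_real r)) mulNr.
Qed.

Lemma norm_sqrt_sqr (n : nat) : `|(Num.sqrt n%:R : R)%:C| ^+ 2 = n%:R :> R[i].
Proof.
by rewrite real_normK ?real_complex_real // -rmorphXn /= sqr_sqrtr
  ?ler0n // rmorph_nat.
Qed.

Lemma norm_imag_div_sqrt_sqr (n : nat) :
  `|'i%C / (Num.sqrt n%:R : R)%:C| ^+ 2 = n%:R^-1 :> R[i].
Proof.
by rewrite normrM exprMn normfV exprVn norm_sqrt_sqr complexiE normCi
  expr1n mul1r.
Qed.

Lemma Eunit_trC (N k l : nat) : (Eunit R N k l)^t* = Eunit R N l k.
Proof. by apply/matrixP => i j; rewrite !mxE conjC_nat andbC. Qed.

Lemma trCD N (A B : 'M[R[i]]_N) : (A + B)^t* = A^t* + B^t*.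
Proof. by rewrite raddfD map_mxD. Qed.

Lemma trCN N (A : 'M[R[i]]_N) : (- A)^t* = - A^t*.
Proof. by rewrite raddfN map_mxN. Qed.

Lemma skewherm_basis_skew (N n : nat) :
  (skewherm_basis R N n)^t* = - skewherm_basis R N n.
Proof.
rewrite /skewherm_basis; case: ifP => _.
  apply: skew_scaleI; first exact: conj_imag_div.
  by rewrite trmx1 map_mx1.
case: ifP => _.
  apply: skew_scaleI; first exact: conj_imag_div.
  rewrite trCD trCN; congr (_ - _).
    by rewrite raddf_sum raddf_sum; apply: eq_bigr => i _; exact: Eunit_trC.
  by apply/matrixP => i j; rewrite !mxE rmorphM /= !conjC_nat andbC.
case: ifP => _; case: (upper_pair _ _) => k l.
  apply: skew_scaleI; first exact: conj_imag_div.
  by rewrite trCD !Eunit_trC addrC.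
apply: skew_scale_real.
  by apply/CrealP; rewrite rpredM ?rpredV ?rpred1 ?real_complex_real.
by rewrite trCD trCN !Eunit_trC opprB.
Qed.

(** Taking [s] to be 1 or -1 gives the symmetric or the antisymmetric family. For [k < l] the two
    matrix units have disjoint supports, and each adds at most 1 to the squared norm. *)
Lemma frob_offdiag_le2 (N k l : nat) (s : R[i]) : s ^+ 2 = 1 ->
  (k < l)%N \/ (k, l) = (0, 0)%N ->
  frob (Eunit R N k l + s *: Eunit R N l k)
       (Eunit R N k l + s *: Eunit R N l k) <= 2.
Proof.
move=> s2 kl.
have s1 : `|s| = 1 by apply/eqP; rewrite -sqrp_eq1 // -normrX s2 normr1.
have E1 a b : \sum_(i < N) \sum_(j < N) ((i.+1 == a) && (j.+1 == b))%:R
    <= 1 :> R[i].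
  have -> : \sum_(i < N) \sum_(j < N) ((i.+1 == a) && (j.+1 == b))%:R =
      ((\sum_(i < N) (i.+1 == a)) * (\sum_(j < N) (j.+1 == b)))%:R :> R[i].
    rewrite natrM !natr_sum mulr_suml; apply: eq_bigr => i _.
    by rewrite mulr_sumr; apply: eq_bigr => j _; rewrite -natrM mulnb.
  by rewrite lern1 (leq_mul (sum_succ_eq_le1 N a) (sum_succ_eq_le1 N b)).
apply: le_trans (lerD (E1 k l) (E1 l k)); rewrite frobxx -big_split /=.
apply: ler_sum => i _; rewrite -big_split /=; apply: ler_sum => j _.
rewrite !mxE; case: kl => [lt|[-> ->]]; last first.
  by rewrite mulr0 addr0 normr0 expr0n.
(* On row [k] the unit at (l, k) vanishes because k < l; on every other row the unit at (k, l)
   does. *)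
have [->|_] /= := eqVneq i.+1 k.
  rewrite (ltn_eqF lt) /= mulr0 !addr0.
  by case: eqP => _; rewrite ?normr1 ?normr0 ?expr1n ?expr0n.
rewrite !add0r normrM s1 mul1r.
by case: (_ && _); rewrite ?normr1 ?normr0 ?expr1n ?expr0n.
Qed.

(** The diagonal holds n - 1 entries 1 and one entry -(n - 1), and (n - 1) + (n - 1)^2 = n(n -
    1). *)
Lemma frob_diag_le (N n : nat) : (0 < n <= N)%N ->
  let M := \sum_(1 <= i < n) Eunit R N i i - n.-1%:R *: Eunit R N n n in
  frob M M <= (n * n.-1)%:R.
Proof.
move=> /andP[n0 nN]; cbv zeta; set M := _ - _.
have ME (i j : 'I_N) : M i j =
    if i == j then (i.+1 < n)%N%:R - (n.-1 * (i.+1 == n))%:R else 0.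
  rewrite !mxE summxE natrM.
  have [->|ij] := eqVneq i j; last first.
    have E k : (i.+1 == k) && (j.+1 == k) = false.
      apply/negP => /andP[/eqP <-]; rewrite eqSS => /eqP ji.
      by move: ij; rewrite -val_eqE /= ji eqxx.
    by rewrite E mulr0 subr0 big1 // => k _; rewrite mxE E.
  rewrite andbb; congr (_ - _).
  under eq_bigr do rewrite mxE andbb.
  have [lt|ge] := ltnP j.+1 n.
    rewrite (bigD1_seq j.+1) ?mem_index_iota ?iota_uniq //= eqxx big1 ?addr0 //.
    by move=> k /negPf kj; rewrite eq_sym kj.
  rewrite big1_seq // => k /=; rewrite mem_index_iota => /andP[_ kn].
  by rewrite gtn_eqF // (leq_trans kn).
(* The entries are integers, so the squared norm is a cast natural number and the bound becomes a
   count. *)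
have -> : frob M M = (\sum_(i < N) ((i.+1 < n) + n.-1 ^ 2 * (i.+1 == n)))%:R.
  rewrite frobxx natr_sum; apply: eq_bigr => i _.
  rewrite (bigD1 i) //= big1 => [|j ji]; last first.
    by rewrite ME eq_sym (negPf ji) normr0 expr0n.
  rewrite addr0 ME eqxx; case: ltngtP => _ /=.
  - by rewrite muln0 subr0 normr1 expr1n muln0 addn0.
  - by rewrite muln0 subr0 normr0 expr0n muln0 addn0.
  - by rewrite !muln1 sub0r normrN normr_nat -natrX.
rewrite ler_nat big_split /= -big_distrr /=.
have -> : (\sum_(i < N) (i.+1 < n) = n.-1)%N.
  rewrite -[RHS]card_ord -sum1_card (big_ord_widen N (fun=> 1%N)); last first.
    by rewrite (leq_trans (leq_pred n)).
  rewrite [RHS]big_mkcond; apply: eq_bigr => i _.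
  by rewrite -ltn_predRL; case: ltnP.
apply: (@leq_trans (n.-1 + n.-1 ^ 2 * 1)).
  by rewrite leq_add2l leq_mul2l sum_succ_eq_le1 orbT.
by rewrite muln1 -{3}(prednK n0) mulSn.
Qed.

(** In each family the squared modulus of the scalar is the reciprocal of a bound on the squared
    norm of the matrix it multiplies: N, n(n - 1), 2 and 2. *)
Lemma skewherm_basis_frob_le1 (N n : nat) : (0 < N)%N -> (0 < n)%N ->
  frob (skewherm_basis R N n) (skewherm_basis R N n) <= 1.
Proof.
move=> N0 n0; rewrite /skewherm_basis; case: ifPn => n1.
  rewrite frobZ norm_imag_div_sqrt_sqr /frob trmx1 map_mx1 mulmx1 mxtrace1.
  by rewrite mulVf // pnatr_eq0 -lt0n.
have {n0}n1 : (1 < n)%N by rewrite ltn_neqAle eq_sym n1.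
have div_le (x : R[i]) (d : nat) : (0 < d)%N -> x <= d%:R -> d%:R^-1 * x <= 1.
  by move=> d0 xd; rewrite mulrC ler_pdivrMr ?ltr0n // mul1r.
case: ifP => nN.
  rewrite frobZ norm_imag_div_sqrt_sqr; apply: div_le.
    by rewrite muln_gt0 (ltnW n1) -ltnS prednK // ltnW.
  by apply: frob_diag_le; rewrite (ltnW n1).
case: ifP => _.
  have := upper_pair_lt N (n - N); case: (upper_pair _ _) => k l /= kl.
  rewrite frobZ norm_imag_div_sqrt_sqr; apply: div_le => //.
  by have := @frob_offdiag_le2 N k l 1 (expr1n _ _) kl; rewrite scale1r.
have := upper_pair_lt N (n - (N * N.+1)./2).
case: (upper_pair _ _) => k l /= kl.
rewrite frobZ mul1r normfV exprVn norm_sqrt_sqr; apply: div_le => //.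
have := @frob_offdiag_le2 N k l (-1) _ kl; rewrite scaleN1r; apply.
by rewrite sqrrN expr1n.
Qed.

(** * Coordinates and norm of the logarithm *)

Lemma log_coordE N (U : 'M[R[i]]_N) q :
  log_coord U q 0 = frob (skewherm_basis R N q.+1) (principal_log U).
Proof.
rewrite frobE exchange_big !mxE.
(* [N ^ 2] unfolds to [N * N], so positions in the stacked vectors are indexed by pairs, column
   first as in [vec]. *)
rewrite (reindex _ (curry_mxvec_bij _ _)) /= pair_bigA /=.
apply: eq_bigr => -[j i] _.
by rewrite !mxE /= !mxvecE !mxE.
Qed.

(** Conjugation by the unitary [Q] preserves both properties, which reduces them to the diagonal
    matrix of the i phi_n. *)
Lemma principal_log_skew_frob N (U L : 'M[R[i]]_N) : is_principal_log U L ->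
  L^t* = - L /\ frob L L <= ((N%:R * pi ^+ 2) : R)%:C.
Proof.
move=> [Q [phi [Qu hphi _ ->]]].
set D := diag_mx _; have DD : D^t* = - D.
  apply/matrixP => i j; rewrite !mxE eq_sym.
  case: eqVneq => [->|_]; last by rewrite !mulr0n rmorph0 oppr0.
  (* Taken at the inverse because that lemma divides by its real argument. *)
  have := conj_imag_div (phi j)^-1.
  by rewrite !mulr1n fmorphV invrK.
split; first by rewrite !trmx_mul !map_mxM /= trmxCK DD mulNmx mulmxN mulmxA.
rewrite frob_unitary_conj // frobxx.
have -> : (N%:R * pi ^+ 2 : R)%:C = \sum_(i < N) (pi ^+ 2 : R)%:C.
  by rewrite sumr_const card_ord rmorphM /= rmorph_nat mulr_natl.
(* Row [i] contributes only its diagonal entry, of modulus |phi_i| <= pi. *)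
apply: ler_sum => i _; rewrite (bigD1 i) //= big1 => [|j ji]; last first.
  by rewrite !mxE eq_sym (negPf ji) mulr0n normr0 expr0n.
rewrite addr0 !mxE eqxx mulr1n normrM complexiE normCi mul1r.
rewrite real_normK ?real_complex_real // -rmorphXn lecR /=.
rewrite -[leLHS]real_normK ?num_real // lerXn2r ?nnegrE ?pi_ge0 //.
by have /andP[h1 h2] := hphi i; rewrite ler_norml h2 ltW.
Qed.

End Basis.

Theorem proposition2 (R : realType) (N : nat) (hN : (0 < N)%N) :
  compact (@cube R (N ^ 2) (Num.sqrt N%:R * pi)) /\
  @log_coord R N @` [set U | U \is unitarymx]
    `<=` map_mx (real_complex R) @` @cube R (N ^ 2) (Num.sqrt N%:R * pi).
Proof.
split; first exact: compact_cube.
move=> _ [U /= Uu <-].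
have [Ls Lb] := principal_log_skew_frob (principal_logP Uu).
have fr q : log_coord U q 0 \is Num.real.
  by rewrite log_coordE frob_skew_real // skewherm_basis_skew.
(* The coordinates are real by [fr], so their real parts form the preimage under the entrywise
   embedding of [R]. *)
pose x := \col_q complex.Re (log_coord U q 0).
have xE q : real_complex R (x q 0) = log_coord U q 0.
  by rewrite mxE; apply/RRe_real.
exists x; last first.
  by apply/matrixP => q z; rewrite (ord1 z) mxE xE.
(* Squaring turns the goal into a bound by N pi^2, which dominates [frob L L] for the logarithm
   L. *)
move=> q; rewrite -ler_norml -ler_sqr ?nnegrE ?mulr_ge0 ?sqrtr_ge0 ?pi_ge0 //.
rewrite real_normK ?num_real // exprMn sqr_sqrtr ?ler0n //.
rewrite -lecR; apply: le_trans Lb; rewrite rmorphXn /= xE log_coordE.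
apply: frob_sqr_le; first exact: skewherm_basis_frob_le1.
by rewrite -log_coordE.
Qed.
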